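(* The restriction of the pairing $\langle-,-\rangle$ to $\mathcal{H}_{\mathcal{SPF}}$ is nondegenerate.
   Context: $\mathbb{K}$ is a commutative field. A double poset is a finite set with two partial orders $(P,\leq_1,\leq_2)$, considered up to isomorphism (bijections preserving and reflecting both orders). A plane poset is a double poset $(P,\leq_h,\leq_r)$ such that two distinct elements are comparable for $\leq_h$ if and only if they are not comparable for $\leq_r$; then $x\leq y$ iff ($x\leq_h y$ or $x\leq_r y$) is a total order on $P$. A plane poset is a plane forest if the Hasse graph of $(P,\leq_h)$ is a rooted forest with roots the minimal elements (for each $x$, $\{y:y\leq_h x\}$ is totally ordered by $\leq_h$). A special plane forest is a double poset $(P,\leq_h,\leq)$ (so $\leq_1=\leq_h$, $\leq_2=\leq$) with $(P,\leq_h,\leq_r)$ a plane forest and $\leq$ the total order on $P$ defined by $x\leq y$ iff ($x\leq_h y$ or $x\leq_r y$). $\mathcal{H}_{\mathcal{SPF}}$ is the $\mathbb{K}$-vector space with basis the isoclasses of special plane forests. The pairing is the symmetric bilinear form such that $\langle P,Q\rangle$ is the (image in $\mathbb{K}$ of the) number of bijections $\sigma:P\to Q$ such that, for all $i,j\in P$: ($i\leq_1 j$ in $P$) implies ($\sigma(i)\leq_2\sigma(j)$ in $Q$), and ($\sigma(i)\leq_1\sigma(j)$ in $Q$) implies ($i\leq_2 j$ in $P$). *)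

(* Defs.v *)
From HB Require Import structures.
From mathcomp Require Import all_boot all_order all_algebra.
From mathcomp Require Import sesquilinear finmap.
From mathcomp Require Import monalg.

Set Implicit Arguments.
Unset Strict Implicit.
Unset Printing Implicit Defensive.

Import GRing.Theory.
Local Open Scope ring_scope.
Local Open Scope quotient_scope.

Section Relations.
Variable T : finType.
Implicit Types h r : rel T.

Definition partial_order r : bool :=
  [&& [forall x, r x x],
      [forall x, forall y, r x y && r y x ==> (x == y)]
    & [forall x, forall y, forall z, r x y && r y z ==> r x z]].

Definition comparable r (x y : T) : bool := r x y || r y x.

Definition plane_poset h r : bool :=
  [&& partial_order h, partial_order r
    & [forall x, forall y,
         (x != y) ==> (comparable h x y == ~~ comparable r x y)]].

Definition plane_forest h r : bool :=
  plane_poset h r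
  && [forall x, forall y, forall z, h y x && h z x ==> comparable h y z].

End Relations.

Definition bijectiveb (S T : finType) (f : {ffun S -> T}) : bool :=
  injectiveb f && [forall y, exists x, f x == y].

Lemma bijectivebP (S T : finType) (f : {ffun S -> T}) :
  reflect (bijective f) (bijectiveb f).
Proof.
apply: (iffP andP) => [[/injectiveP injf /forallP surjf]|[g fK gK]].
  have surj y : {x | f x = y}.
    have /existsP ex := surjf y.
    by exists (xchoose ex); apply/eqP/(xchooseP ex).
  exists (fun y => sval (surj y)) => [x|y]; last exact: svalP (surj y).
  by apply: injf; apply: svalP (surj (f x)).
split; first by apply/injectiveP/(can_inj fK).
by apply/forallP => y; apply/existsP; exists (g y); rewrite gK.
Qed.

(* Up to isomorphism every finite set is some 'I_n, so the double posets are   *)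
(* taken on the carriers 'I_n; this makes them a choiceType.                   *)
Definition two_rels : Type :=
  {n : nat & ({set 'I_n * 'I_n} * {set 'I_n * 'I_n})%type}.
HB.instance Definition _ := Choice.on two_rels.

Definition carrier (P : two_rels) : finType := 'I_(tag P).
Coercion carrier : two_rels >-> finType.

Definition le1 (P : two_rels) : rel P := fun i j => (i, j) \in (tagged P).1.
Definition le2 (P : two_rels) : rel P := fun i j => (i, j) \in (tagged P).2.
Arguments le1 : clear implicits.
Arguments le2 : clear implicits.

Record double_poset := DoublePoset {
  dp_rels :> two_rels;
  _ : partial_order (le1 dp_rels) && partial_order (le2 dp_rels) }.
HB.instance Definition _ := [isSub for dp_rels].
HB.instance Definition _ := [Choice of double_poset by <:].

Definition dp_iso (P Q : double_poset) : bool :=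
  [exists f : {ffun P -> Q},
     bijectiveb f
     && [forall i, forall j, (le1 Q (f i) (f j) == le1 P i j)
                          && (le2 Q (f i) (f j) == le2 P i j)]].

Lemma dp_isoP (P Q : double_poset) :
  reflect (exists2 f : P -> Q, bijective f &
             (forall i j, le1 Q (f i) (f j) = le1 P i j) /\
             (forall i j, le2 Q (f i) (f j) = le2 P i j))
          (dp_iso P Q).
Proof.
apply: (iffP existsP) => [[f /andP[/bijectivebP bf /forallP H]]|[f bf [H1 H2]]].
  exists f => //; split=> i j.
    by have /forallP/(_ j)/andP[/eqP] := H i.
  by have /forallP/(_ j)/andP[_ /eqP] := H i.
exists (finfun f); apply/andP; split.
  by apply/bijectivebP/(eq_bij bf) => i; rewrite ffunE.
by apply/forallP => i; apply/forallP => j; rewrite !ffunE H1 H2 !eqxx.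
Qed.

Lemma dp_iso_refl : reflexive dp_iso.
Proof. by move=> P; apply/dp_isoP; exists id => //; exists id. Qed.

Lemma dp_iso_imp_sym (P Q : double_poset) : dp_iso P Q -> dp_iso Q P.
Proof.
move=> /dp_isoP[f [g fK gK] [H1 H2]]; apply/dp_isoP; exists g.
  by exists f.
by split=> i j; [rewrite -H1 | rewrite -H2]; rewrite !gK.
Qed.

Lemma dp_iso_sym : symmetric dp_iso.
Proof. by move=> P Q; apply/idP/idP; apply: dp_iso_imp_sym. Qed.

Lemma dp_iso_trans : transitive dp_iso.
Proof.
move=> Q P S /dp_isoP[f bf [H1 H2]] /dp_isoP[g bg [G1 G2]].
apply/dp_isoP; exists (g \o f); first exact: bij_comp.
by split=> i j /=; rewrite ?G1 ?G2.
Qed.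

Canonical dp_iso_equiv := EquivRel dp_iso dp_iso_refl dp_iso_sym dp_iso_trans.

Definition dp_class : choiceType := {eq_quot dp_iso}.

(* The relation R is the order <=_r, which a special plane forest              *)
(* (P, <=_h, <=) only records through <=.                                      *)
Definition special_plane_forest (P : double_poset) : bool :=
  [exists R : {set P * P},
     plane_forest (le1 P) [rel x y | (x, y) \in R]
     && [forall x, forall y, le2 P x y == (le1 P x y || ((x, y) \in R))]].

Lemma special_plane_forest_iso (P Q : double_poset) :
  dp_iso P Q -> special_plane_forest P = special_plane_forest Q.
Proof.
have imp (A B : double_poset) :
    dp_iso A B -> special_plane_forest A -> special_plane_forest B.
  move=> /dp_isoP[f [g fK gK] [H1 H2]] /existsP[R /andP[]].
  move=> /andP[/and3P[_ /and3P[/forallP rR /forallP aR /forallP tR] /forallP cR]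
               /forallP fR] /forallP eR.
  have oB1 : partial_order (le1 B) by case: (B) => B' /= /andP[].
  apply/existsP; exists [set p | (g p.1, g p.2) \in R].
  have E x y : le1 B x y = le1 A (g x) (g y) by rewrite -H1 !gK.
  have E2 x y : le2 B x y = le2 A (g x) (g y) by rewrite -H2 !gK.
  apply/andP; split; last first.
    apply/forallP => x; apply/forallP => y; rewrite inE E E2 /=.
    by have /forallP/(_ (g y)) := eR (g x).
  apply/andP; split; last first.
    apply/forallP => x; apply/forallP => y; apply/forallP => z.
    rewrite /comparable !E.
    by have /forallP/(_ (g y))/forallP/(_ (g z)) := fR (g x).
  apply/and3P; split => //.
    apply/and3P; split.
    - by apply/forallP => x; rewrite /= inE /=; apply: rR.
    - apply/forallP => x; apply/forallP => y; rewrite /= !inE /=.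
      by have /forallP/(_ (g y)) := aR (g x); rewrite /= (can_eq gK).
    - apply/forallP => x; apply/forallP => y; apply/forallP => z.
      rewrite /= !inE /=.
      by have /forallP/(_ (g y))/forallP/(_ (g z)) := tR (g x).
  apply/forallP => x; apply/forallP => y.
  rewrite /comparable !E /= !inE /=.
  by have /forallP/(_ (g y)) := cR (g x); rewrite /comparable /= (can_eq gK).
by move=> PQ; apply/idP/idP; apply: imp => //; apply: dp_iso_imp_sym.
Qed.

Definition spf_class (c : dp_class) : bool := special_plane_forest (repr c).

Lemma spf_class_pi (P : double_poset) :
  spf_class (\pi_dp_class P) = special_plane_forest P.
Proof. by apply: special_plane_forest_iso; apply/eqmodP; rewrite reprK. Qed.

Definition pictures (P Q : double_poset) : {set {ffun P -> Q}} :=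
  [set s | bijectiveb s
         & [forall i, forall j,
              (le1 P i j ==> le2 Q (s i) (s j))
              && (le1 Q (s i) (s j) ==> le2 P i j)]].

Lemma picturesP (P Q : double_poset) (s : {ffun P -> Q}) :
  reflect [/\ bijective s,
              forall i j, le1 P i j -> le2 Q (s i) (s j)
            & forall i j, le1 Q (s i) (s j) -> le2 P i j]
          (s \in pictures P Q).
Proof.
rewrite inE; apply: (iffP andP) => [[/bijectivebP bs /forallP H]|[bs H1 H2]].
  split=> // i j; have /forallP/(_ j)/andP[] := H i.
    by move=> /implyP.
  by move=> _ /implyP.
split; first exact/bijectivebP.
apply/forallP => i; apply/forallP => j.
by apply/andP; split; apply/implyP; [apply: H1 | apply: H2].
Qed.

Lemma leq_card_pictures_sym (P Q : double_poset) :
  (#|pictures P Q| <= #|pictures Q P|)%N.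
Proof.
have [->|[s0 /picturesP[[g0 _ _] _ _]]] := set_0Vmem (pictures P Q).
  by rewrite cards0.
pose inv (s : {ffun P -> Q}) : {ffun Q -> P} :=
  [ffun y => odflt (g0 y) [pick x | s x == y]].
have invP s : s \in pictures P Q -> cancel s (inv s) /\ cancel (inv s) s.
  case/picturesP=> [[g sK gK] _ _].
  have K : cancel (inv s) s.
    by move=> y; rewrite ffunE; case: pickP => [x /eqP //|/(_ (g y))];
      rewrite gK eqxx.
  by split=> // x; apply: (can_inj sK); rewrite K.
have inj : {in pictures P Q &, injective inv}.
  move=> s t /invP[sK _] /invP[_ tK] E; apply/ffunP => x.
  by rewrite -[LHS]tK -E sK.
rewrite -(card_in_imset inj); apply/subset_leq_card/subsetP => _ /imsetP[s Ps ->].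
have [sK Ks] := invP s Ps; have [_ H1 H2] := picturesP s Ps.
apply/picturesP; split=> [|i j ij|i j ij]; first by exists s.
  by apply: H2; rewrite !Ks.
by rewrite -[i]Ks -[j]Ks; apply: H1.
Qed.

Lemma card_pictures_sym (P Q : double_poset) :
  #|pictures P Q| = #|pictures Q P|.
Proof. by apply/eqP; rewrite eqn_leq !leq_card_pictures_sym. Qed.

Lemma card_pictures_iso (P P' Q Q' : double_poset) :
  dp_iso P P' -> dp_iso Q Q' -> #|pictures P Q| = #|pictures P' Q'|.
Proof.
have le (A A' B : double_poset) :
    dp_iso A A' -> (#|pictures A' B| <= #|pictures A B|)%N.
  case/dp_isoP=> f bf [H1 H2].
  pose F (s : {ffun A' -> B}) : {ffun A -> B} := [ffun x => s (f x)].
  have inj : injective F.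
    case: bf => g _ gK s t E; apply/ffunP => x.
    by have := congr1 (fun u : {ffun A -> B} => u (g x)) E; rewrite !ffunE gK.
  rewrite -(card_imset _ inj); apply/subset_leq_card/subsetP => _ /imsetP[s + ->].
  case/picturesP=> bs S1 S2; apply/picturesP; split.
  - by apply: (eq_bij (bij_comp bs bf)) => x; rewrite ffunE.
  - by move=> i j ij; rewrite !ffunE; apply: S1; rewrite H1.
  - by move=> i j; rewrite !ffunE => /S2; rewrite H2.
have E (A A' B : double_poset) : dp_iso A A' -> #|pictures A B| = #|pictures A' B|.
  by move=> h; apply/eqP; rewrite eqn_leq !le // dp_iso_sym.
by move=> PP' QQ'; rewrite (E _ _ _ PP') card_pictures_sym (E _ _ _ QQ')
  card_pictures_sym.
Qed.

Definition nb_pictures (c d : dp_class) : nat := #|pictures (repr c) (repr d)|.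

Lemma nb_pictures_pi (P Q : double_poset) :
  nb_pictures (\pi_dp_class P) (\pi_dp_class Q) = #|pictures P Q|.
Proof. by apply: card_pictures_iso; apply/eqmodP; rewrite reprK. Qed.

Section Pairing.
Variable K : fieldType.

(* The vector space with basis the isoclasses of all double posets.            *)
Definition H_DP : lmodType K := {malg K[dp_class]}.
Implicit Types x y z : {malg K[dp_class]}.

Definition pairing (x y : H_DP) : K :=
  \sum_(c <- msupp x) \sum_(d <- msupp y) x@_c * y@_d * (nb_pictures c d)%:R.

Lemma pairingEw (A B : {fset dp_class}) x y :
  (msupp x `<=` A)%fset -> (msupp y `<=` B)%fset ->
  pairing x y = \sum_(c <- A) \sum_(d <- B) x@_c * y@_d * (nb_pictures c d)%:R.
Proof.
move=> sA sB; rewrite /pairing (big_fset_incl _ sA) /=; last first.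
  move=> c _ /mcoeff_outdom xc; rewrite big1 // => d _.
  by rewrite xc !mul0r.
apply: eq_bigr => c _; apply: (big_fset_incl _ sB) => d _ /mcoeff_outdom yd.
by rewrite yd mulr0 mul0r.
Qed.

Lemma pairingC x y : pairing x y = pairing y x.
Proof.
rewrite /pairing exchange_big; apply: eq_bigr => d _; apply: eq_bigr => c _.
by rewrite [x@_c * _]mulrC /nb_pictures card_pictures_sym.
Qed.

Lemma pairing_is_linear x : linear_for *%R (pairing x).
Proof.
move=> a y z; pose B := (msupp y `|` msupp z)%fset.
have sy : (msupp y `<=` B)%fset by apply: fsubsetUl.
have sz : (msupp z `<=` B)%fset by apply: fsubsetUr.
have s : (msupp (a *: y + z) `<=` B)%fset.
  apply: fsubset_trans (msuppD_le _ _) _.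
  by rewrite fsetSU // msuppZ_le.
rewrite !(@pairingEw (msupp x) B) // mulr_sumr -big_split /=.
apply: eq_bigr => c _; rewrite mulr_sumr -big_split /=.
apply: eq_bigr => d _; rewrite mcoeffD mcoeffZ.
by rewrite mulrDr mulrDl mulrCA -!mulrA.
Qed.

Lemma pairing_bilinear : bilinear_for *%R *%R pairing.
Proof.
split=> [y|x] a u v; last exact: pairing_is_linear.
by rewrite !(pairingC _ y) pairing_is_linear.
Qed.

HB.instance Definition _ :=
  bilinear_isBilinear.Build K H_DP H_DP K *%R *%R pairing pairing_bilinear.

Lemma pairingUU (P Q : double_poset) :
  pairing << \pi_dp_class P >> << \pi_dp_class Q >> = #|pictures P Q|%:R.
Proof.
rewrite (pairingEw (msuppU_le) (msuppU_le)) !big_seq_fset1.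
by rewrite !mcoeffUU !mul1r nb_pictures_pi.
Qed.

(* The subspace of H_DP spanned by the isoclasses of special plane forests.    *)
Definition H_SPF : {pred H_DP} :=
  [pred x : {malg K[dp_class]} | all spf_class (msupp x)].

Lemma H_SPF_submod : submod_closed H_SPF.
Proof.
split=> [|a x y /allP Hx /allP Hy]; first by rewrite inE msupp0.
apply/allP => c /(fsubsetP (msuppD_le _ _)); rewrite in_fsetU.
by case/orP => [/(fsubsetP (msuppZ_le _ _)) /Hx | /Hy].
Qed.

HB.instance Definition _ :=
  GRing.isSubmodClosed.Build K H_DP H_SPF H_SPF_submod.

End Pairing.

Arguments H_SPF K x : clear implicits.
Arguments pairing K x y : clear implicits.

Definition nondegenerate_on (K : fieldType) (V : lmodType K) (W : {pred V})
    (b : {biscalar V}) : Prop :=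
  (forall x, x \in W -> (forall y, y \in W -> b x y = 0) -> x = 0) /\
  (forall y, y \in W -> (forall x, x \in W -> b x y = 0) -> y = 0).

(* Main.v *)
Require Import Defs.
From mathcomp Require Import all_boot all_order all_algebra all_fingroup.
From mathcomp Require Import sesquilinear finmap monalg.
From mathcomp Require Import zify.

Set Implicit Arguments.
Unset Strict Implicit.
Unset Printing Implicit Defensive.

Import Order.TTheory GRing.Theory.

(** The Gram matrix of the pairing splits along the sizes of the forests, and
    each block is a product of three matrices, all unitriangular once rows and
    columns are suitably matched; its determinant is therefore 1 or -1, which
    makes the pairing nondegenerate over every field.

    Sorting a special plane forest by its total order puts it on the set
    {0, ..., n-1} with the natural order. Only the descendance relation
    [desc F i j] remains, and the descendants of a vertex form an interval
    that starts at this vertex. A picture from F to G becomes a permutation s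
    that increases along F and whose inverse increases along G. Among the
    forests along which s increases there is a largest one, [run s]: the
    descendants of i are the maximal interval of positions starting at i on
    which s stays above s i. Hence
      pairing F G = # {s | F is contained in run s, G in run s^-1},
    that is, pairing = Z^T N Z where Z is the inclusion matrix of forests and
    N A B = # {s | run s = A, run s^-1 = B}. Inclusion matrices are
    unitriangular, so everything rests on N.

    Each forest A is [run w] for some permutation w avoiding the pattern 213
    ([forest_perm]), and the inverse of w avoids 213 as well. The row A of N
    is matched with the column B = run w^-1. The reason for this choice is
    [run_key_lt]: if t <> w but run t^-1 = run w^-1, then [run t] is smaller
    than [run w] for the lexicographic comparison of the numbers of
    descendants of 0, 1, ..., n-1. So in the column matched with A, the entry
    of A is 1 and all the other nonzero entries lie at smaller forests. *)

(** * Permutations with a prescribed order of values *)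

Section Ranking.
Variable n : nat.

Lemma card_ord_below (i : 'I_n) : #|[set k : 'I_n | k < i]| = i.
Proof.
have le_in : i <= n by apply: ltnW.
by rewrite -sum1dep_card (big_ord_narrow le_in) big_const_ord iter_addn_0 mul1n.
Qed.

Lemma perm_rankE (s : 'S_n) (i : 'I_n) : #|[set k | s k < s i]| = s i.
Proof.
rewrite -[RHS]card_ord_below.
rewrite -(card_preimset [set k : 'I_n | k < s i] (@perm_inj _ s)).
by apply: eq_card => k; rewrite !inE.
Qed.

Lemma perm_by_order (s t : 'S_n) :
  (forall i j, (s i < s j) = (t i < t j)) -> s = t.
Proof.
move=> st; apply/permP => i; apply/val_inj => /=.
by rewrite -perm_rankE -[RHS]perm_rankE; apply: eq_card => k; rewrite !inE st.
Qed.

(** Sends each element to the number of elements below it. *)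
Lemma ranking_perm (r : rel 'I_n) :
    irreflexive r -> transitive r -> (forall i j, i != j -> r i j || r j i) ->
  exists s : 'S_n, forall i j, (s i < s j) = r i j.
Proof.
move=> rI rT rtot; pose below i := [set k | r k i].
have lt_n i : #|below i| < n.
  rewrite -[n in _ < n]card_ord; apply: proper_card; apply/properP; split.
    by apply/subsetP.
  by exists i; rewrite // inE rI.
have lt_r i j : r i j -> #|below i| < #|below j|.
  move=> ij; apply: proper_card; apply/properP; split.
    by apply/subsetP => k; rewrite !inE => /rT; apply.
  by exists i; rewrite !inE ?rI.
have rank_inj : injective (fun i => Ordinal (lt_n i)).
  move=> i j [eq_ij]; apply/eqP; apply: contraT => /rtot.
  by case/orP=> /lt_r; rewrite eq_ij ltnn.
exists (perm rank_inj) => i j; rewrite !permE /=.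
apply/idP/idP => [lt_ij|/lt_r //]; apply: contraTT lt_ij => nij.
rewrite -leqNgt; have [->//|/rtot] := eqVneq i j.
by rewrite (negPf nij) /= => /lt_r/ltnW.
Qed.

End Ranking.

(** * Triangular systems *)

Local Open Scope ring_scope.

(** The multiplicities are natural numbers so that the lemma serves both for
    inclusion matrices, whose entries are booleans, and for counting matrices;
    besides c a, the equation of a involves only indices with a smaller key, so
    a nonzero coefficient with the smallest key is alone in its equation. *)
Lemma triangular_eq0 (disp : Order.disp_t) (O : orderType disp) (T : finType)
    (V : zmodType) (key : T -> O) (M : T -> T -> nat) (c : T -> V) :
    (forall a, \sum_b c b *+ M a b = 0) -> (forall a, M a a = 1%N) ->
    (forall a b, M a b != 0%N -> b != a -> (key b < key a)%O) ->
  forall a, c a = 0.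
Proof.
move=> ker diag tri a; apply/eqP/negPn/negP => ca.
have [b cb b_min] := @arg_minP _ O T a (fun b => c b != 0) key ca.
have := ker b; rewrite (bigD1 b) //= diag big1 => [|b' b'b].
  by rewrite addr0 => /eqP; apply/negP.
have [-> //|Mbb'] := eqVneq (M b b') 0%N.
suff /eqP -> : c b' == 0 by rewrite mul0rn.
apply: contraT => /b_min; rewrite leNgt => /negP[]; exact: tri.
Qed.

Local Close Scope ring_scope.

(** * Forests as relations on ordinals *)

Section Forests.
Variable n : nat.
Implicit Types (i j k : 'I_n) (h : {set 'I_n * 'I_n}) (s t w v : 'S_n).

(** In a plane forest on {0, ..., n-1} whose total order is the natural one, if
    i <=_h j and i < k < j then k cannot be on the right of i: either k <=_r j,
    which would give i <=_r j, or k <=_h j, and then i and k are comparable for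
    <=_h because the poset is a forest. This is the convexity required here;
    conversely it makes the complementary relation <=_r transitive. *)
Definition forest_rel h : bool :=
  [&& [forall i : 'I_n, (i, i) \in h],
      [forall i : 'I_n, forall j : 'I_n, ((i, j) \in h) ==> (i <= j)],
      [forall i : 'I_n, forall j : 'I_n, forall k : 'I_n,
         ((i, j) \in h) && (i <= k <= j) ==> ((i, k) \in h)]
    & [forall i : 'I_n, forall j : 'I_n, forall k : 'I_n,
         ((i, j) \in h) && ((j, k) \in h) ==> ((i, k) \in h)]].

Lemma forest_relP h :
  reflect [/\ forall i, (i, i) \in h, forall i j, (i, j) \in h -> i <= j,
              forall i j k, (i, j) \in h -> i <= k <= j -> (i, k) \in h
            & forall i j k, (i, j) \in h -> (j, k) \in h -> (i, k) \in h]
          (forest_rel h).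
Proof.
apply: (iffP and4P) => -[h1 h2 h3 h4]; split.
- exact/forallP.
- by move=> i j; move/forallP/(_ i)/forallP/(_ j)/implyP: h2.
- move=> i j k hij hk; move/forallP/(_ i)/forallP/(_ j)/forallP/(_ k): h3.
  by rewrite hij hk.
- move=> i j k hij hk; move/forallP/(_ i)/forallP/(_ j)/forallP/(_ k): h4.
  by rewrite hij hk.
- exact/forallP.
- by apply/forallP => i; apply/forallP => j; apply/implyP/h2.
- apply/forallP => i; apply/forallP => j; apply/forallP => k.
  by apply/implyP => /andP[]; apply: h3.
- apply/forallP => i; apply/forallP => j; apply/forallP => k.
  by apply/implyP => /andP[]; apply: h4.
Qed.

Definition forest := {h : {set 'I_n * 'I_n} | forest_rel h}.
Implicit Types F G : forest.

Definition desc F i j := (i, j) \in val F.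

Let descP F := elimT (forest_relP (val F)) (valP F).

Lemma desc_refl F i : desc F i i.
Proof. by have [h _ _ _] := descP F; apply: h. Qed.

Lemma desc_leq F i j : desc F i j -> i <= j.
Proof. by have [_ h _ _] := descP F; apply: h. Qed.

Lemma desc_convex F i j k : desc F i j -> i <= k <= j -> desc F i k.
Proof. by have [_ _ h _] := descP F; apply: h. Qed.

Lemma desc_trans F i j k : desc F i j -> desc F j k -> desc F i k.
Proof. by have [_ _ _ h] := descP F; apply: h. Qed.

Lemma desc_comparable F i j k :
  desc F j i -> desc F k i -> desc F j k || desc F k j.
Proof.
move=> Fji Fki; have ji := desc_leq Fji; have ki := desc_leq Fki.
have [jk|kj] := leqP j k; apply/orP.
  by left; apply: desc_convex Fji _; rewrite jk.
by right; apply: desc_convex Fki _; rewrite (ltnW kj).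
Qed.

(** The condition tying <=_h and <=_r in a plane poset, where i <=_r j holds
    when i <= j and j is not a descendant of i. *)
Lemma desc_total F i j : i != j ->
  (desc F i j || desc F j i) =
    ~~ ((i <= j) && ~~ desc F i j || (j <= i) && ~~ desc F j i).
Proof.
move=> nij; have := @desc_leq F i j; have := @desc_leq F j i.
have {nij} : (i : nat) != j by [].
by case: (desc F i j); case: (desc F j i) => /=; lia.
Qed.

Lemma desc_inj F G : desc F =2 desc G -> F = G.
Proof. by move=> FG; apply/val_inj/setP => -[i j]; apply: FG. Qed.

(** * The largest forest along which a permutation increases *)

Definition run_set s : {set 'I_n * 'I_n} :=
  [set p : 'I_n * 'I_n | (p.1 <= p.2) &&
     [forall k : 'I_n, (p.1 <= k <= p.2) ==> (s p.1 <= s k)]].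

Lemma run_setP s i j :
  reflect (i <= j /\ forall k, i <= k <= j -> s i <= s k)
          ((i, j) \in run_set s).
Proof.
rewrite inE /=; apply: (iffP andP) => -[ij /= sij]; split=> //.
  by move=> k; apply/implyP; move/forallP: sij.
by apply/forallP => k; apply/implyP/sij.
Qed.

Lemma run_forest s : forest_rel (run_set s).
Proof.
apply/forest_relP; split=> [i|i j|i j k|i j k].
- apply/run_setP; split=> // k; rewrite -eqn_leq => /eqP/val_inj-> //.
- by case/run_setP.
- move=> /run_setP[ij sij] ikj; apply/run_setP; split=> [|l il]; first lia.
  by apply: sij; lia.
move=> /run_setP[ij sij] /run_setP[jk sjk]; apply/run_setP; split=> [|l il].
  lia.
have [lj|jl] := leqP l j; first by apply: sij; lia.
by have := sij j; have := sjk l; lia.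
Qed.

Definition run s : forest := Sub (run_set s) (run_forest s).

Lemma runP s i j :
  reflect (i <= j /\ forall k, i <= k <= j -> s i <= s k) (desc (run s) i j).
Proof. exact: run_setP. Qed.

(** A permutation increasing along F increases from i to every position between
    i and one of its descendants, since these are descendants of i too. *)
Lemma sub_runP F s :
  reflect (forall i j, desc F i j -> s i <= s j) (val F \subset val (run s)).
Proof.
apply: (iffP subsetP) => [sub i j /sub/run_setP[ij]|incr [i j] Fij].
  by apply; rewrite ij leqnn.
apply/run_setP; split=> [|k ikj]; first exact: desc_leq Fij.
by apply: incr; apply: desc_convex Fij ikj.
Qed.

(** * Permutations avoiding 213 *)

Definition avoids213 s := forall i j k, i < j < k -> s j < s i -> s k < s i.

Lemma avoids213V s : avoids213 s -> avoids213 s^-1.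
Proof.
move=> av i j k ijk vji; rewrite ltnNge leq_eqVlt; apply/negP.
case/orP=> [/eqP/val_inj/perm_inj ik|vik]; first by rewrite ik in ijk; lia.
by have := av (s^-1 j)%g (s^-1 i)%g (s^-1 k)%g; rewrite vji vik !permKV; lia.
Qed.

Lemma avoids213_run s i j :
  avoids213 s -> i <= j -> s i <= s j -> desc (run s) i j.
Proof.
move=> av ij sij; apply/runP; split=> // k ikj; rewrite leqNgt; apply/negP.
move=> ski; have ik : i != k by apply: contraTneq ski => ->; rewrite ltnn.
have kj : k != j by apply: contraTneq ski => ->; rewrite -leqNgt.
have := av i k j; rewrite ski => /(_ _ isT).
by move: ik kj; rewrite -!val_eqE /=; lia.
Qed.

(** Order the positions by putting ancestors before descendants and, among
    vertices not related by descendance, those on the right before those on the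
    left. The permutation ranking this order inverts as many pairs as F
    permits. *)
Lemma forest_perm F : exists2 s, avoids213 s & run s = F.
Proof.
pose r : rel 'I_n := fun i j => if i < j then desc F i j else
  (j < i) && ~~ desc F j i.
have r_trans : transitive r.
  move=> j i k; rewrite /r.
  case: (ltngtP i j) => // ij; case: (ltngtP j k) => // jk /=.
  - by rewrite (ltn_trans ij jk); apply: desc_trans.
  - move=> Fij nFkj; case: (ltngtP i k) => [ik|ki|/val_inj eik] /=.
    + by apply: desc_convex Fij _; lia.
    + by apply: contra nFkj => Fki; apply: desc_trans Fki Fij.
    + by rewrite -eik Fij in nFkj.
  - move=> nFji Fjk; case: (ltngtP i k) => [ik|ki|/val_inj eik] /=.
    + by case/negP: nFji; apply: desc_convex Fjk _; lia.
    + by apply: contra nFji; apply: desc_trans.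
    + by rewrite eik Fjk in nFji.
  - move=> _; have ki := ltn_trans jk ij; rewrite ki (leq_gtF (ltnW ki)) /=.
    by apply: contra => Fki; apply: desc_convex Fki _; lia.
have [|//||s sE] := @ranking_perm n r.
- by move=> i; rewrite /r ltnn.
- move=> i j; rewrite /r -val_eqE /=.
  by case: ltngtP => //= _ _; rewrite ?orbN ?orNb.
have sdesc i j : i <= j -> (s i <= s j) = desc F i j.
  rewrite leq_eqVlt => /orP[/eqP/val_inj->|ij].
    by rewrite leqnn desc_refl.
  by rewrite leqNgt sE /r ij ltnNge (ltnW ij) /= negbK.
have av : avoids213 s.
  move=> i j k /andP[ij jk]; rewrite !ltnNge !sdesc; try lia.
  by apply: contra => /desc_convex; apply; lia.
exists s => //; apply: desc_inj => i j; apply/idP/idP => [|ij].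
  by case/runP=> ij /(_ j); rewrite ij leqnn sdesc //; apply.
by apply: avoids213_run; rewrite ?sdesc // (desc_leq ij).
Qed.

(** * The lexicographic comparison of runs *)

Definition descs F y := [set u | desc F y u].

(** Compare the positions v = w^-1 and t^-1 of the values, at the least x where
    t and w disagree. If w x < t x, then v increases between these two places,
    hence t^-1 too because the runs agree, against the choice of x. If
    t x < w x, then v decreases between them, so t^-1 takes a value y < x in
    between; x stays a descendant of y in [run w], by avoidance of 213, but
    not in [run t]. *)
Lemma run_descs_diff t w :
    avoids213 w -> run t^-1 = run w^-1 -> t != w ->
  exists x : 'I_n, (forall y : 'I_n, y < x -> t y = w y) /\
    exists2 y : 'I_n, y < x & descs (run t) y != descs (run w) y.
Proof.
move=> av eq_run neq_tw.
have [x0 tw0] : exists x, t x != w x.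
  by apply/existsP; apply: contraNT neq_tw => /existsPn tw;
    apply/eqP/permP => x; apply/eqP; move: (tw x); rewrite negbK.
have [x twx x_min] := @arg_minnP _ x0 (fun x => t x != w x) (@nat_of_ord n) tw0.
have tw_lt (y : 'I_n) : y < x -> t y = w y.
  by move=> yx; apply/eqP; apply: contraTT yx => /x_min; rewrite -leqNgt.
exists x; split=> //.
have ge_x i : (forall y : 'I_n, y < x -> w y != i) -> x <= (t^-1 i)%g.
  move=> wi; rewrite leqNgt; apply/negP => ti.
  by move: (wi _ ti); rewrite -tw_lt // permKV eqxx.
have x_le_tw : x <= (t^-1 (w x))%g.
  apply: ge_x => y yx; rewrite (inj_eq perm_inj); apply: contraTneq yx => ->.
  by rewrite ltnn.
have x_le_wt : x <= (w^-1 (t x))%g.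
  rewrite leqNgt; apply/negP => wx.
  have := tw_lt _ wx; rewrite permKV => /perm_inj eq_x.
  by rewrite eq_x ltnn in wx.
have [lt_wt|lt_tw|/val_inj eq_tw] := ltngtP (w x) (t x); last first.
- by rewrite eq_tw eqxx in twx.
- have ndesc : ~~ desc (run t^-1) (t x) (w x).
    apply/negP; rewrite eq_run => /runP[_ /(_ (w x))]; rewrite permK.
    rewrite leqnn (ltnW lt_tw) => /(_ isT) le_x.
    have /val_inj : x = (w^-1 (t x))%g :> nat by lia.
    by move/(congr1 w); rewrite permKV => eq_tw; rewrite eq_tw eqxx in twx.
  have [k] : exists k : 'I_n, (t x <= k <= w x) && ((t^-1 k)%g < x).
    apply/existsP; apply: contraNT ndesc => /existsPn nk.
    apply/runP; split=> [|k kk]; first exact: ltnW.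
    by move: (nk k); rewrite kk /= permK -leqNgt.
  set y := (t^-1 k)%g => /andP[kk yx].
  have tyk : t y = k by rewrite /y permKV.
  exists y => //; apply/negP => /eqP/setP/(_ x); rewrite !inE.
  have -> : desc (run w) y x.
    apply: avoids213_run => //; first exact: ltnW.
    by rewrite -tw_lt // tyk; lia.
  move=> /runP[_ /(_ x)].
  rewrite leqnn (ltnW yx) tyk => /(_ isT) le_k.
  have /val_inj/perm_inj eq_xy : t x = t y :> nat by rewrite tyk; lia.
  by rewrite eq_xy ltnn in yx.
have : desc (run w^-1) (w x) (t x).
  apply: avoids213_run; first exact: avoids213V.
    exact: ltnW.
  by rewrite permK.
rewrite -eq_run => /runP[_ /(_ (t x))]; rewrite leqnn (ltnW lt_wt) permK.
move=> /(_ isT) le_x.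
have /val_inj : x = (t^-1 (w x))%g :> nat by lia.
by move/(congr1 t); rewrite permKV => eq_tw; rewrite eq_tw eqxx in twx.
Qed.

(** Otherwise w u < w y for some descendant u > y of y in [run t], so t takes
    on ]y, u] values above t y = w y. By avoidance of 213, w takes values above
    w y only before u; it does not take those of t on ]y, u] before y, where it
    agrees with t. Hence w^-1 o t would map ]y, u] injectively into ]y, u[. *)
Lemma run_descs_sub t w (y : 'I_n) :
    avoids213 w -> (forall z : 'I_n, z <= y -> t z = w z) ->
  descs (run t) y \subset descs (run w) y.
Proof.
move=> av tw; apply/subsetP => u0; rewrite !inE => Tu0.
apply/negPn/negP => /runP Wu0; apply: Wu0; split; first exact: desc_leq Tu0.
move=> u yu; rewrite leqNgt; apply/negP => wu.
have /runP[_ tu] : desc (run t) y u by apply: desc_convex Tu0 yu.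
have lt_yu : y < u.
  by rewrite ltn_neqAle; case/andP: yu => -> _; rewrite andbT;
    apply: contraTneq wu => /val_inj->; rewrite ltnn.
have inj_f : injective (fun z => (w^-1 (t z))%g).
  by move=> a b /perm_inj/perm_inj.
pose I := [set z : 'I_n | y < z <= u].
suff /subset_leq_card : [set (w^-1 (t z))%g | z in I] \subset I :\ u.
  by rewrite card_imset // [#|I|](cardsD1 u) inE lt_yu leqnn ltnn.
apply/subsetP => _ /imsetP[z + ->]; rewrite !inE => /andP[yz zu].
set z' := (w^-1 (t z))%g; have wz' : w z' = t z by rewrite permKV.
have lt_wy : w y < w z'.
  rewrite wz' -tw // ltn_neqAle tu ?(ltnW yz) // andbT.
  by apply: contraTneq yz => /val_inj/perm_inj->; rewrite ltnn.
have yz' : y < z'.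
  rewrite ltnNge; apply/negP => z'y; have := tw _ z'y; rewrite wz'.
  by move/perm_inj => zz'; rewrite zz' in z'y; lia.
have uz' : u != z' by apply: contraTneq lt_wy => <-; rewrite -leqNgt ltnW.
rewrite eq_sym uz' yz' leqNgt /=; apply/negP => lt_uz'.
by have := av y u z'; rewrite lt_yu lt_uz' => /(_ isT wu); lia.
Qed.

Definition desc_key F : n.-tuplelexi nat := [tuple #|descs F y| | y < n].

Lemma run_key_lt t w :
    avoids213 w -> run t^-1 = run w^-1 -> t != w ->
  (desc_key (run t) < desc_key (run w))%O.
Proof.
move=> av eq_run neq_tw.
have [x [tw [y0 y0x diff0]]] := run_descs_diff av eq_run neq_tw.
have [y diff y_min] := @arg_minnP _ y0
  (fun y => descs (run t) y != descs (run w) y) (@nat_of_ord n) diff0.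
apply/ltxi_tuplePlt; exists y => [z zy|]; rewrite !tnth_mktuple.
  suff -> : descs (run t) z = descs (run w) z by [].
  by apply/eqP; apply: contraTT zy => /y_min; rewrite -leqNgt.
rewrite ltEnat; apply: proper_card; rewrite properEneq diff /=.
apply: run_descs_sub => // z zy; apply: tw.
by have := y_min _ diff0; lia.
Qed.

(** * Independence of the rows of the Gram matrix *)

Definition picture_perms F G : {set 'S_n} :=
  [set s | (val F \subset val (run s)) && (val G \subset val (run s^-1))].

(** Gives unitriangularity of the inclusion matrix of forests. *)
Lemma proper_forest_card F G :
  val F \subset val G -> F != G -> #|val F| < #|val G|.
Proof. by move=> FG nFG; apply: proper_card; rewrite properEneq FG andbT. Qed.

Local Open Scope ring_scope.

(** Writes the Gram matrix as Z^T N Z and cancels the three factors in turn: C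
    collects the coefficients c after Z, and D those after N Z. *)
Lemma picture_perms_independent (V : zmodType) (c : forest -> V) :
    (forall G, \sum_F c F *+ #|picture_perms F G| = 0) ->
  forall F, c F = 0.
Proof.
move=> ker_c.
pose C (A : forest) := \sum_(F : forest | val F \subset val A) c F.
pose D (B : forest) := \sum_(s : 'S_n | run s^-1 == B) C (run s).
have D0 (B : forest) : D B = 0.
  (* The equation of G involves the forests containing G, whence a key that
     decreases with the number of pairs. *)
  move: B; apply: (@triangular_eq0 _ nat forest V (fun B => n * n - #|val B|)%N
    (fun G B => val G \subset val B) D) => [G|G|G B].
  - rewrite -[RHS](ker_c G).
    under [RHS]eq_bigr => F _ do rewrite -sumr_const.
    rewrite (exchange_big_dep (fun s : 'S_n => val G \subset val (run s^-1)));
      last by move=> F s _; rewrite inE => /andP[].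
    under [LHS]eq_bigr => B _ do rewrite mulrb.
    rewrite -big_mkcond.
    rewrite [RHS](partition_big (fun s : 'S_n => run s^-1)
      (fun B => val G \subset val B)) //.
    apply: eq_bigr => B GB; apply: eq_big => [s|s /eqP sB].
      by have [eB|] := eqP; rewrite ?andbF // eB GB.
    by apply: eq_bigl => F; rewrite inE sB GB andbT.
  - by rewrite subxx.
  rewrite eqb0 negbK => GB nBG.
  have /= lt_GB : (#|val G| < #|val B|)%N.
    by apply: proper_forest_card; rewrite // eq_sym.
  have /= le_B : (#|val B| <= n * n)%N.
    by apply: leq_trans (max_card _) _; rewrite card_prod card_ord.
  by rewrite ltEnat /= ltn_sub2l // (leq_trans lt_GB).
have C0 (A : forest) : C A = 0.
  have [w w_av w_run] := fin_all_exists2 forest_perm.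
  move: A; apply: (@triangular_eq0 _ (n.-tuplelexi nat) forest V desc_key
    (fun A A' => #|[set s | (run s == A') && (run s^-1 == run (w A)^-1)]|) C)
    => [A|A|A A'].
  - rewrite -[RHS](D0 (run (w A)^-1)) /D (partition_big run xpredT) //=.
    apply: eq_bigr => A' _; rewrite -sumr_const.
    apply: eq_big => [s|s]; rewrite inE; first by rewrite andbC.
    by case/andP=> /eqP->.
  - apply/eqP/cards1P; exists (w A); apply/setP => s; rewrite !inE.
    apply/andP/eqP => [[/eqP sA /eqP sw]|->]; last by rewrite w_run.
    apply/eqP; apply: contraT => /(run_key_lt (w_av A) sw).
    by rewrite sA w_run ltxx.
  rewrite -lt0n => /card_gt0P[s]; rewrite inE => /andP[/eqP <- /eqP sw] nsA.
  suff : s != w A by move/(run_key_lt (w_av A) sw); rewrite w_run.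
  by apply: contraNneq nsA => ->; rewrite w_run.
apply: (@triangular_eq0 _ nat forest V (fun A => #|val A|)
  (fun A F => val F \subset val A) c) => [A|A|A F].
- rewrite -[RHS](C0 A) [RHS]big_mkcond /=.
  by apply: eq_bigr => F _; rewrite mulrb.
- by rewrite subxx.
by rewrite eqb0 negbK ltEnat; apply: proper_forest_card.
Qed.

End Forests.

(** * Special plane forests up to isomorphism *)

Lemma partial_orderP (T : finType) (r : rel T) :
  reflect [/\ reflexive r, antisymmetric r & transitive r] (partial_order r).
Proof.
apply: (iffP and3P) => -[r_refl r_anti r_trans]; split.
- exact/forallP.
- move=> x y; move/forallP/(_ x)/forallP/(_ y)/implyP: r_anti => r_anti.
  by move/r_anti/eqP.
- move=> y x z rxy ryz; move/forallP/(_ x)/forallP/(_ y)/forallP/(_ z): r_trans.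
  by rewrite rxy ryz.
- exact/forallP.
- by apply/forallP => x; apply/forallP => y; apply/implyP => /r_anti->.
- apply/forallP => x; apply/forallP => y; apply/forallP => z.
  by apply/implyP => /andP[]; apply: r_trans.
Qed.

Section ForestPosets.
Variable n : nat.
Implicit Types (i j k : 'I_n) (F G : forest n).
Local Open Scope quotient_scope.

Definition forest_rels F : two_rels :=
  existT _ n (val F, [set p : 'I_n * 'I_n | p.1 <= p.2]).

Lemma forest_rels_order F :
  partial_order (le1 (forest_rels F)) && partial_order (le2 (forest_rels F)).
Proof.
apply/andP; split; apply/partial_orderP; split.
- exact: desc_refl.
- move=> i j /andP[/desc_leq ij /desc_leq ji].
  by apply/val_inj/eqP; rewrite eqn_leq ij ji.
- by move=> j i k; apply: desc_trans.
- by move=> i; rewrite /le2 inE /=.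
- by move=> i j; rewrite /le2 !inE -eqn_leq => /eqP/val_inj.
- by move=> j i k; rewrite /le2 !inE; apply: leq_trans.
Qed.

Definition forest_poset F : double_poset := DoublePoset (forest_rels_order F).

Lemma forest_poset_le1 F i j : le1 (forest_poset F) i j = desc F i j.
Proof. by []. Qed.

Lemma forest_poset_le2 F i j : le2 (forest_poset F) i j = (i <= j).
Proof. by rewrite /le2 inE. Qed.

Lemma forest_poset_spf F : special_plane_forest (forest_poset F).
Proof.
apply/existsP; exists [set p : 'I_n * 'I_n |
  (p.1 <= p.2) && ((p.1 == p.2) || ~~ desc F p.1 p.2)].
apply/andP; split; last first.
  apply/forallP => i; apply/forallP => j.
  rewrite forest_poset_le2 forest_poset_le1 inE /=; apply/eqP.
  have := @desc_leq n F i j; have [->|nij] := eqVneq i j.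
    by rewrite leqnn orbT.
  by case: desc => [->|_] //=; rewrite andbT.
apply/andP; split; last first.
  apply/forallP => i; apply/forallP => j; apply/forallP => k.
  rewrite /Defs.comparable !forest_poset_le1; apply/implyP => /andP[Fji Fki].
  exact: desc_comparable Fji Fki.
apply/and3P; split.
- by case/andP: (forest_rels_order F).
- apply/partial_orderP; split.
  + by move=> i; rewrite /= inE /= leqnn eqxx.
  + move=> i j; rewrite /= !inE /= => /andP[/andP[ij _] /andP[ji _]].
    by apply/val_inj/eqP; rewrite eqn_leq ij.
  + move=> j i k; rewrite /= !inE /= => /andP[ij Rij] /andP[jk Rjk].
    rewrite (leq_trans ij jk) /=.
    case/predU1P: Rij => [-> //|nFij].
    by apply/orP; right; apply: contra nFij => /desc_convex; apply; rewrite ij.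
apply/forallP => i; apply/forallP => j; apply/implyP => nij; apply/eqP.
rewrite /Defs.comparable !forest_poset_le1 /= !inE /= [j == i]eq_sym.
by rewrite (negPf (nij : i != j :> 'I_n)); apply: desc_total.
Qed.

(** An isomorphism preserves the natural order of the ordinals, so it is the
    identity. *)
Lemma forest_poset_iso_eq F G :
  dp_iso (forest_poset F) (forest_poset G) -> F = G.
Proof.
case/dp_isoP=> /= f bij_f [f1 f2].
have f_inj : injective (f : 'I_n -> 'I_n) := bij_inj bij_f.
have f_id : perm f_inj = 1%g.
  apply: perm_by_order => i j; rewrite !permE !ltnNge.
  by have := f2 j i; rewrite !forest_poset_le2 => ->.
apply: desc_inj => i j; have := f1 i j.
by rewrite !forest_poset_le1 -!(permE f_inj) f_id !perm1.
Qed.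

Lemma forest_class_inj : injective (fun F => \pi_dp_class (forest_poset F)).
Proof. by move=> F G /eqmodP; apply: forest_poset_iso_eq. Qed.

Lemma card_forest_pictures F G :
  #|pictures (forest_poset F) (forest_poset G)| = #|picture_perms F G|.
Proof.
pose graph (s : 'S_n) : {ffun forest_poset F -> forest_poset G} := finfun s.
have graph_inj : injective graph.
  by move=> s t st; apply/permP => i; move/ffunP/(_ i): st; rewrite !ffunE.
rewrite -(card_imset _ graph_inj); apply: eq_card => f.
apply/picturesP/imsetP => [[bij_f f1 f2]|[s + ->]].
  have f_inj : injective (f : 'I_n -> 'I_n) := bij_inj bij_f.
  exists (perm f_inj); last by apply/ffunP => i; rewrite ffunE permE.
  rewrite inE; apply/andP; split; apply/sub_runP => i j.
    by move=> /f1; rewrite forest_poset_le2 !permE.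
  rewrite -{1}(permKV (perm f_inj) i) -{1}(permKV (perm f_inj) j).
  move: (_ i) (_ j) => a b.
  by rewrite !permE => /f2; rewrite forest_poset_le2.
rewrite inE => /andP[/sub_runP s1 /sub_runP s2]; split.
- by exists (fun i => (s^-1)%g i) => i; rewrite ffunE ?permK ?permKV.
- by move=> i j /s1; rewrite forest_poset_le2 !ffunE.
- by move=> i j; rewrite !ffunE => /s2; rewrite !permK forest_poset_le2.
Qed.

End ForestPosets.

Lemma pictures_size_neq n m (F : forest n) (G : forest m) :
  m != n -> #|pictures (forest_poset F) (forest_poset G)| = 0.
Proof.
move=> nmn; apply: eq_card0 => f; apply/negP => /picturesP[/bij_eq_card].
by rewrite !card_ord => nm; case/eqP: nmn; rewrite -[m]nm.
Qed.

(** Number the vertices by the total order; the relation <=_h becomes a forest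
    relation by the argument given for [forest_rel]. *)
Lemma spf_forest (P : double_poset) :
  special_plane_forest P ->
  exists F : forest (tag (dp_rels P)), dp_iso P (forest_poset F).
Proof.
case/existsP=> R /andP[/andP[/and3P[_ R_po /forallP R_xor] /forallP h_forest]].
move/forallP=> le2E.
have /andP[/partial_orderP[h_refl h_anti h_trans]
           /partial_orderP[l_refl l_anti l_trans]] :
  partial_order (le1 P) && partial_order (le2 P) by case: (P).
have {R_po} /partial_orderP[_ _ R_trans] := R_po.
have {}le2E x y : le2 P x y = le1 P x y || ((x, y) \in R).
  by apply/eqP; move/forallP: (le2E x).
have {}R_xor x y : x != y ->
    Defs.comparable (le1 P) x y = ~~ (((x, y) \in R) || ((y, x) \in R)).
  by move=> nxy; apply/eqP; move/forallP/(_ y): (R_xor x); rewrite nxy.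
have {}h_forest x y z : le1 P y x -> le1 P z x -> Defs.comparable (le1 P) y z.
  move=> yx zx; move/forallP/(_ y)/forallP/(_ z): (h_forest x).
  by rewrite yx zx.
have l_total x y : x != y -> le2 P x y || le2 P y x.
  move=> nxy; rewrite !le2E orbACA -[X in _ || X]negbK -R_xor //.
  exact: orbN.
have [|||s sE] := @ranking_perm (tag (dp_rels P))
  (fun x y => (x != y) && le2 P x y).
- by move=> x; rewrite eqxx.
- move=> y x z /andP[nxy lxy] /andP[nyz lyz].
  rewrite (l_trans _ _ _ lxy lyz) andbT.
  apply: contraNneq nxy => xz; rewrite -xz in lyz.
  by apply/eqP/l_anti; rewrite lxy.
- by move=> x y nxy; rewrite nxy eq_sym nxy l_total.
have sleE x y : (s x <= s y) = le2 P x y.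
  rewrite leqNgt sE; have [->|nyx] := eqVneq y x; first by rewrite l_refl.
  have := l_total y x nyx; case lyx: (le2 P y x) => //= _.
  by apply/esym/negbTE; apply: contra nyx => lxy; apply/eqP/l_anti; rewrite lyx.
pose h : {set 'I_(tag (dp_rels P)) * 'I_(tag (dp_rels P))} :=
  [set p | le1 P ((s^-1)%g p.1) ((s^-1)%g p.2)].
have h_leq i j : (i, j) \in h -> i <= j.
  by rewrite inE /= -{2}(permKV s i) -{2}(permKV s j) sleE le2E => ->.
have hF : forest_rel h.
  apply/forest_relP; split=> // [i|i j k|i j k]; rewrite ?inE //=;
    last exact: h_trans.
  set a := (s^-1)%g i; set b := (s^-1)%g j; set c := (s^-1)%g k => hab.
  rewrite -(permKV s i) -(permKV s j) -(permKV s k) !sleE -/a -/b -/c.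
  case/andP=> lac lcb.
  have [eab|nab] := eqVneq a b.
    by rewrite -eab in lcb; rewrite (l_anti a c) ?h_refl // lac.
  have [hcb|nhcb] := boolP (le1 P c b).
    case/orP: (h_forest _ _ _ hab hcb) => // hca.
    by rewrite (l_anti a c) ?h_refl // lac le2E hca.
  apply: contraT => nhac; move: lac lcb.
  rewrite !le2E (negPf nhcb) (negPf nhac) /=.
  move=> Rac Rcb; have Rab : (a, b) \in R by apply: R_trans Rac Rcb.
  by have := R_xor _ _ nab; rewrite /Defs.comparable hab Rab.
exists (Sub h hF); apply/dp_isoP; exists s.
  by exists (fun i => (s^-1)%g i) => i; rewrite ?permK ?permKV.
split=> i j; last by rewrite forest_poset_le2 sleE.
by rewrite forest_poset_le1 /desc SubK inE /= !permK.
Qed.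

(** * The pairing *)

Section Pairing.
Variable K : fieldType.
Local Open Scope ring_scope.
Local Open Scope quotient_scope.

Lemma spf_class_forest c :
  spf_class c ->
  exists n, exists F : forest n, c = \pi_dp_class (forest_poset F).
Proof.
move=> /spf_forest[F isoF]; exists _, F.
by rewrite -[LHS]reprK; apply/eqmodP.
Qed.

Lemma forest_in_H_SPF n (F : forest n) :
  << \pi_dp_class (forest_poset F) >> \in H_SPF K.
Proof.
apply/allP => c /(fsubsetP msuppU_le); rewrite inE => /eqP->.
by rewrite spf_class_pi forest_poset_spf.
Qed.

(** Forests of other sizes have no pictures to G, so only the coefficients of x
    at the forests of size n count. *)
Lemma pairing_forest (x : H_DP K) n (G : forest n) : x \in H_SPF K ->
  pairing K x << \pi_dp_class (forest_poset G) >> =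
  \sum_(F : forest n)
    x@_(\pi_dp_class (forest_poset F)) *+ #|picture_perms F G|.
Proof.
move=> /allP x_spf; pose cl (F : forest n) := \pi_dp_class (forest_poset F).
have cl_inj : injective cl := @forest_class_inj n.
pose val_at c := x@_c *+ nb_pictures c (cl G).
transitivity (\sum_(c <- msupp x) val_at c).
  rewrite (pairingEw (fsubset_refl _) msuppU_le); apply: eq_bigr => c _.
  by rewrite big_seq_fset1 mcoeffUU mulr1 mulr_natr.
pose cls := [seq cl F | F <- enum {: forest n}].
transitivity (\sum_(c <- cls) val_at c); last first.
  rewrite big_map big_enum; apply: eq_bigr => F _.
  by rewrite /val_at nb_pictures_pi card_forest_pictures.
rewrite (bigID (mem cls)) /=.
rewrite [X in _ + X]big_seq_cond [X in _ + X]big1 ?addr0; last first.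
  move=> c /andP[xc]; have [m [F ->]] := spf_class_forest (x_spf c xc).
  have [mn|nmn] := eqVneq m n.
    by subst m; rewrite map_f // mem_enum.
  by rewrite /val_at nb_pictures_pi pictures_size_neq ?mulr0n // eq_sym.
rewrite [RHS](bigID (mem (msupp x))) /= [X in _ + X]big1 ?addr0; last first.
  by move=> c xc; rewrite /val_at mcoeff_outdom ?mul0rn.
rewrite -big_filter -[RHS]big_filter; apply: perm_big; apply: uniq_perm.
- exact/filter_uniq/fset_uniq.
- by rewrite filter_uniq // map_inj_uniq ?enum_uniq.
by move=> c; rewrite !mem_filter andbC.
Qed.

Lemma pairing_left_kernel (x : {malg K[dp_class]}) : x \in H_SPF K ->
  (forall y, y \in H_SPF K -> pairing K x y = 0) -> x = 0.
Proof.
move=> x_spf ker; apply/malgP => c; rewrite mcoeff0.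
have [xc|/mcoeff_outdom //] := boolP (c \in msupp x).
have [n [F ->]] := spf_class_forest (allP x_spf c xc).
apply: (@picture_perms_independent n _
  (fun F => x@_(\pi_dp_class (forest_poset F)))).
by move=> G; rewrite -pairing_forest // ker // forest_in_H_SPF.
Qed.

End Pairing.

Theorem corollary6p6 (K : fieldType) :
  nondegenerate_on (H_SPF K) (pairing K).
Proof.
split=> [x|y]; first exact: pairing_left_kernel.
move=> y_spf ker; apply: pairing_left_kernel => // x x_spf.
by rewrite pairingC ker.
Qed.
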